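(* Let $0\le\zeta^{in}\in L^1_{0,1}$, let $\varphi\in L^1_{0,1}$, and let $\mathcal{A}:\mathbb{R}_{>0}^3\to[0,\infty)$ be a measurable function with $\mathcal{A}(x,y;z)=0$ whenever $z>x$. Assume that for some constant $A\ge0$, $\mathcal{A}(x,y;z)\le A\,\varphi(z)$ if $x+y<1$ and $\mathcal{A}(x,y;z)\le A\,(x+y)\,\varphi(z)$ if $x+y>1$. Then every weak solution $\zeta$ (in the sense defined in the context) to the continuous generalized exchange-driven growth equation with kernel $\mathcal{A}$ and initial condition $\zeta^{in}$ satisfies, for all $t>0$, $$\int_0^\infty\zeta(t,x)\,dx=\int_0^\infty\zeta^{in}(x)\,dx .$$
   Context: $\mathbb{R}_{>0}=(0,\infty)$, and $L^1_{0,1}=L^1(\mathbb{R}_{>0},(1+x)\,dx)$ with its standard norm. $\mathcal{C}([0,\infty),w\text{-}L^1(\mathbb{R}_{>0}))$ is the set of functions from $[0,\infty)$ to $L^1(\mathbb{R}_{>0})$ that are continuous for the weak topology of $L^1(\mathbb{R}_{>0})$. The continuous generalized exchange-driven growth equation is, for $x>0$, $t\ge0$, $$\begin{aligned}\partial_t\zeta(t,x)=&\int_0^\infty\!\!\int_0^\infty \mathcal{A}(x+z,y;z)\zeta(t,x+z)\zeta(t,y)\,dy\,dz-\int_0^\infty\!\!\int_z^\infty \mathcal{A}(y,x;z)\zeta(t,y)\zeta(t,x)\,dy\,dz\\&+\int_0^x\!\!\int_z^\infty \mathcal{A}(y,x-z;z)\zeta(t,y)\zeta(t,x-z)\,dy\,dz-\int_0^x\!\!\int_0^\infty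 \mathcal{A}(x,y;z)\zeta(t,x)\zeta(t,y)\,dy\,dz,\end{aligned}$$ with $\zeta(0,x)=\zeta^{in}(x)\ge 0$ a.e. Weak solution: given $0\le\zeta^{in}\in L^1_{0,1}$, a function $\zeta$ is a weak solution if (a) $0\le\zeta\in\mathcal{C}([0,\infty),w\text{-}L^1(\mathbb{R}_{>0}))\cap L^\infty(0,T;L^1_{0,1})$ for every $T>0$; and (b) for every $t\ge0$ and every smooth $\omega\in L^\infty(\mathbb{R}_{>0})$, $$\int_0^\infty\omega(x)[\zeta(t,x)-\zeta^{in}(x)]\,dx=\int_0^t\int_0^\infty\int_0^\infty\int_0^x\tilde\omega(x,y,z)\,\mathcal{A}(x,y;z)\,\zeta(s,x)\,\zeta(s,y)\,dz\,dy\,dx\,ds,$$ where $\tilde\omega(x,y,z)=\omega(y+z)+\omega(x-z)-\omega(x)-\omega(y)$. *)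

(* Defs.v *)
From HB Require Import structures.
From mathcomp Require Import all_boot all_order all_algebra.
From mathcomp Require Import all_classical all_reals all_analysis.

Set Implicit Arguments.
Unset Strict Implicit.
Unset Printing Implicit Defensive.
Import Order.TTheory GRing.Theory Num.Theory.
Import numFieldNormedType.Exports.

Local Open Scope classical_set_scope.
Local Open Scope ring_scope.

Section Spaces.
Context {R : realType}.
Local Notation mu := (@lebesgue_measure R).

(* Elements of function spaces over (0, oo) are represented by functions
   R -> R; their values on (-oo, 0] are irrelevant, and functions which agree
   almost everywhere on (0, oo) represent the same element. *)
Definition Rpos : set R := `]0, +oo[.

Definition in_L1 (f : R -> R) : Prop := mu.-integrable Rpos (EFin \o f).

Definition L1_norm (f : R -> R) : \bar R :=
  (\int[mu]_(x in Rpos) `|f x|%:E)%E.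

Definition L01_norm (f : R -> R) : \bar R :=
  (\int[mu]_(x in Rpos) ((1 + x) * `|f x|)%:E)%E.

Definition in_L01 (f : R -> R) : Prop :=
  measurable_fun Rpos f /\ (L01_norm f < +oo)%E.

Definition in_Linfty (f : R -> R) : Prop :=
  measurable_fun Rpos f /\
  exists C : R, {ae mu, forall x, 0 < x -> `|f x| <= C}.

Definition ae_nonneg (f : R -> R) : Prop :=
  {ae mu, forall x, 0 < x -> 0 <= f x}.

Definition smooth_on_Rpos (f : R -> R) : Prop :=
  forall (n : nat) (x : R), 0 < x -> derivable (derive1n n f) x 1.

(* Continuous linear functionals on L^1(0, oo). Boundedness forces l to take
   equal values on functions that agree almost everywhere. *)
Definition L1_dual (l : (R -> R) -> R) : Prop :=
  (forall (a : R) (f g : R -> R), in_L1 f -> in_L1 g ->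
     l (fun x => a * f x + g x) = a * l f + l g) /\
  exists C : R, forall f : R -> R, in_L1 f ->
    ((`|l f|)%:E <= C%:E * L1_norm f)%E.

(* The weak topology is the initial topology of the continuous linear
   functionals, so a curve is weakly continuous iff its composition with each
   of them is continuous. *)
Definition weakly_continuous_L1 (u : R -> R -> R) : Prop :=
  (forall t, 0 <= t -> in_L1 (u t)) /\
  forall l, L1_dual l ->
    {within `[0, +oo[, continuous (fun t : R => l (u t))}.

Definition simple_L01 (s : R -> R -> R) : Prop :=
  exists (k : nat) (E : 'I_k -> set R) (c : 'I_k -> R -> R),
    [/\ forall i, measurable (E i),
        forall i, in_L01 (c i) &
        forall t x, s t x = \sum_(i < k) \1_(E i) t * c i x].

(* Strong (Bochner) measurability of u : (0, T) -> L^1((0, oo), (1 + x) dx). *)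
Definition strongly_measurable_L01 (T : R) (u : R -> R -> R) : Prop :=
  exists s : nat -> R -> R -> R,
    (forall n, simple_L01 (s n)) /\
    {ae mu, forall t, 0 < t < T ->
       L01_norm (fun x => s n t x - u t x) @[n --> \oo] --> 0%E}.

Definition in_Linfty_L01 (T : R) (u : R -> R -> R) : Prop :=
  [/\ {ae mu, forall t, 0 < t < T -> in_L01 (u t)},
      strongly_measurable_L01 T u &
      exists C : R, {ae mu, forall t, 0 < t < T -> (L01_norm (u t) <= C%:E)%E}].

End Spaces.

Section ExchangeDrivenGrowth.
Context {R : realType}.
Local Notation mu := (@lebesgue_measure R).

Definition exchange_test (w : R -> R) (x y z : R) : R :=
  w (y + z) + w (x - z) - w x - w y.

(* [K x y z] is the kernel at (x, y; z) and [zeta t x] the unknown. *)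
Definition weak_solution (K : R -> R -> R -> R) (zeta_in : R -> R)
    (zeta : R -> R -> R) : Prop :=
  [/\ forall t, 0 <= t -> ae_nonneg (zeta t),
      weakly_continuous_L1 zeta,
      forall T, 0 < T -> in_Linfty_L01 T zeta &
      forall (t : R) (w : R -> R), 0 <= t ->
        smooth_on_Rpos w -> in_Linfty w ->
        (\int[mu]_(x in Rpos) (w x * (zeta t x - zeta_in x))%:E =
         \int[mu]_(s in `[0%R, t]) \int[mu]_(x in Rpos) \int[mu]_(y in Rpos)
           \int[mu]_(z in `]0%R, x[)
             (exchange_test w x y z * K x y z * zeta s x * zeta s y)%:E)%E].

End ExchangeDrivenGrowth.

(* Main.v *)
Require Import Defs.
From HB Require Import structures.
From mathcomp Require Import all_boot all_order all_algebra.
From mathcomp Require Import all_classical all_reals all_analysis.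
From mathcomp Require Import measurable_realfun.

Set Implicit Arguments.
Unset Strict Implicit.
Unset Printing Implicit Defensive.
Import Order.TTheory GRing.Theory Num.Theory.
Import numFieldNormedType.Exports.

Local Open Scope classical_set_scope.
Local Open Scope ring_scope.

(** The constant function 1 is an admissible test function in the weak
    formulation, and an exchange moves mass between two clusters without
    changing their number: [exchange_test] of a constant is 1 + 1 - 1 - 1 = 0.
    The right-hand side of the weak formulation therefore
    vanishes for this test function, and its left-hand side is the integral of
    [zeta t - zeta_in]. What remains is to split this integral, which requires
    both terms to be integrable: [zeta t] takes values in L^1 by the definition
    of weak continuity, and [zeta_in] lies in L^1 because the weight 1 + x is at
    least 1 on the half-line ([in_L01_in_L1]). *)

Lemma measurable_Rpos (R : realType) : measurable (@Rpos R).
Proof. exact: measurable_itv. Qed.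

Lemma in_L01_in_L1 (R : realType) (f : R -> R) : in_L01 f -> in_L1 f.
Proof.
move=> [mf f_fin]; apply/integrableP; split; first exact/measurable_EFinP.
apply: le_lt_trans f_fin; apply: ge0_le_integral => //=.
- exact: measurable_Rpos.
- by apply/measurable_EFinP; exact: measurableT_comp.
- apply/measurable_EFinP; apply: measurable_funM; last exact: measurableT_comp.
  exact: measurable_funD.
- move=> x; rewrite /Rpos /= in_itv /= andbT => x_gt0.
  by rewrite lee_fin ler_peMl// lerDl ltW.
Qed.

Lemma smooth_on_Rpos_cst (R : realType) (c : R) : smooth_on_Rpos (cst c).
Proof.
have cst_derive1n n : exists d : R, derive1n n (cst c : R -> R) = cst d.
  elim: n => [|n [d IHn]]; first by exists c.
  exists 0; rewrite derive1nS IHn; apply/funext => x; exact: derive1_cst.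
by move=> n x _; have [d ->] := cst_derive1n n; exact: derivable_cst.
Qed.

Lemma in_Linfty_cst (R : realType) (c : R) : in_Linfty (cst c).
Proof.
split; first exact: measurable_cst.
by exists `|c|; apply: aeW => x _.
Qed.

Lemma exchange_test_cst (R : realType) (c x y z : R) :
  exchange_test (cst c) x y z = 0.
Proof. by rewrite /exchange_test /= addrK subrr. Qed.

Theorem theorem2p6 (R : realType) (zeta_in phi : R -> R)
    (K : R -> R -> R -> R) (a : R)
    (zeta_in_ge0 : ae_nonneg zeta_in)
    (zeta_in_L01 : in_L01 zeta_in)
    (phi_L01 : in_L01 phi)
    (K_ge0 : forall x y z : R, 0 < x -> 0 < y -> 0 < z -> 0 <= K x y z)
    (K_meas : measurable_fun (Rpos `*` Rpos `*` Rpos)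
                (fun p : R * R * R => K p.1.1 p.1.2 p.2))
    (K_eq0 : forall x y z : R, 0 < x -> 0 < y -> 0 < z -> x < z ->
               K x y z = 0)
    (a_ge0 : 0 <= a)
    (K_small : forall x y z : R, 0 < x -> 0 < y -> 0 < z -> x + y < 1 ->
                 K x y z <= a * phi z)
    (K_large : forall x y z : R, 0 < x -> 0 < y -> 0 < z -> 1 < x + y ->
                 K x y z <= a * (x + y) * phi z)
    (zeta : R -> R -> R) (zeta_sol : weak_solution K zeta_in zeta)
    (t : R) (t_gt0 : 0 < t) :
  (\int[lebesgue_measure]_(x in Rpos) (zeta t x)%:E =
   \int[lebesgue_measure]_(x in Rpos) (zeta_in x)%:E)%E.
Proof.
case: zeta_sol => _ [zeta_L1 _] _ weak_eq.
have zt_int := zeta_L1 t (ltW t_gt0).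
have zin_int := in_L01_in_L1 zeta_in_L01.
have := weak_eq t (cst 1) (ltW t_gt0)
  (@smooth_on_Rpos_cst R 1) (@in_Linfty_cst R 1).
under [RHS]eq_integral do under eq_integral do under eq_integral do
  under eq_integral do rewrite exchange_test_cst !mul0r.
under [RHS]eq_integral do under eq_integral do under eq_integral do
  rewrite integral0.
under [RHS]eq_integral do under eq_integral do rewrite integral0.
under [RHS]eq_integral do rewrite integral0.
rewrite integral0.
under eq_integral do rewrite mul1r EFinB.
rewrite integralB//; last exact: measurable_Rpos.
by move/eqP; rewrite sube_eq ?fin_num_adde_defl ?integrable_fin_num ?add0e //;
  [move/eqP | exact: measurable_Rpos..].
Qed.
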